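(* Let $S \not= \emptyset$ be a subset of a Minkowski space $(\mathbb{R}^n, \| \cdot \|)$ such that $$\dim (\operatorname{aff} (\operatorname{bh}_1 (S))) \in \{0,1,n-1,n\}.$$ Then $$\operatorname{bh}_1 (S) = \operatorname{cl} \left(\bigcup_{F \subseteq S,\ F \text{ finite}} \operatorname{bh}_1 (F)\right).$$
   Context: A Minkowski space $(\mathbb{R}^n,\|\cdot\|)$ is $\mathbb{R}^n$, $n\ge 1$, equipped with an arbitrary norm. For $x\in\mathbb{R}^n$ and $r\ge 0$, $B(x,r)=\{y:\|y-x\|\le r\}$ is the closed ball; $\operatorname{cl}$ denotes closure and $\operatorname{aff}$ affine hull. The ball hull of $S\subseteq\mathbb{R}^n$ is $\operatorname{bh}_1(S)=\bigcap_{x\in\mathbb{R}^n:\,S\subseteq B(x,1)}B(x,1)$, where the intersection of an empty family is $\mathbb{R}^n$. *)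

(* Defs.v *)
From HB Require Import structures.
From mathcomp Require Import all_boot all_order all_algebra.
From mathcomp Require Import boolp classical_sets cardinality reals topology.
From mathcomp Require Import normedtype.

Set Implicit Arguments.
Unset Strict Implicit.
Unset Printing Implicit Defensive.

Import Order.TTheory GRing.Theory Num.Theory.
Import numFieldNormedType.Exports.

Local Open Scope classical_set_scope.
Local Open Scope ring_scope.

(* Nonnegativity is not a field: it follows from the other three axioms. *)
Record rVnorm (R : realType) (n : nat) := RVNorm {
  rVnorm_fun :> 'rV[R]_n -> R;
  rVnorm_triangle : forall x y, rVnorm_fun (x + y) <= rVnorm_fun x + rVnorm_fun y;
  rVnormZ : forall (a : R) x, rVnorm_fun (a *: x) = `|a| * rVnorm_fun x;
  rVnorm0_eq0 : forall x, rVnorm_fun x = 0 -> x = 0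
}.

(* 'rV[R]_n already carries the canonical sup-norm structure of the library.
   This alias instead receives the norm [N] and the topology induced by [N]. *)
Definition minkowski (R : realType) (n : nat) (N : rVnorm R n) : Type := 'rV[R]_n.

Section MinkowskiStructure.
Variables (R : realType) (n : nat) (N : rVnorm R n).

HB.instance Definition _ := GRing.Lmodule.copy (minkowski N) 'rV[R]_n.
HB.instance Definition _ := Vector.copy (minkowski N) 'rV[R]_n.
HB.instance Definition _ := Lmodule_isNormed.Build R (minkowski N)
  (@rVnorm_triangle R n N) (@rVnormZ R n N) (@rVnorm0_eq0 R n N).

Lemma minkowski_normE (x : minkowski N) : `|x| = N x.
Proof. by []. Qed.

Lemma minkowski_dim : \dim {:minkowski N} = n.
Proof. by rewrite dimvf /dim /= mul1n. Qed.

End MinkowskiStructure.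

(* The library's [closed_ball] is the closure of the open ball, which is empty
   for radius 0; hence the explicit definition. *)
Definition cball (R : realType) (V : normedModType R) (x : V) (r : R) : set V :=
  [set y | `|y - x| <= r].

(* [\bigcap] over the empty family is [setT]. *)
Definition ball_hull1 (R : realType) (V : normedModType R) (S : set V) : set V :=
  \bigcap_(x in [set x : V | S `<=` cball x 1]) cball x 1.

Definition affine_hull (R : realType) (V : lmodType R) (A : set V) : set V :=
  [set y | exists (k : nat) (a : 'I_k -> R) (p : 'I_k -> V),
     [/\ forall i, A (p i), \sum_(i < k) a i = 1
       & y = \sum_(i < k) a i *: p i]].

(* [has_affine_dim E d]: E is an affine subspace, i.e. a translate of a linear
   subspace, of dimension d; such a d is unique, and there is none if E is
   empty. *)
Definition has_affine_dim (R : realType) (V : vectType R) (E : set V) (d : nat)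
    : Prop :=
  exists (p : V) (U : {vspace V}),
    \dim U = d /\ E = [set p + u | u in [set u : V | u \in U]].

(* Main.v *)
Require Import Defs.
From HB Require Import structures.
From mathcomp Require Import all_boot all_order all_algebra.
From mathcomp Require Import boolp classical_sets cardinality reals topology.
From mathcomp Require Import normedtype.
From mathcomp Require Import finmap ring lra derive.

Set Implicit Arguments.
Unset Strict Implicit.
Unset Printing Implicit Defensive.

Import Order.TTheory GRing.Theory Num.Theory.
Import numFieldNormedType.Exports.

Local Open Scope classical_set_scope.
Local Open Scope ring_scope.

(** Write [K = ball_hull1 S], and call [x] a centre for [A] when [A] lies in the
unit ball around [x].  The union [T] of the hulls of the finite subsets of [S]
lies in the closed set [K], so what has to be shown is that [T] is dense in [K].

The centres for [S] are the intersection of the centres for the finite subsets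
of [S], and unit balls are compact.  Hence, if a point [y] is within distance 1
of all points of the unit ball around some fixed [s0] in [S] that are close to
a centre for [S], then [y] is within distance 1 of all centres for some finite
[F], that is, [y] lies in [T] ([finitary_ball_hull1_local]).  In particular [T]
is the whole space when [S] has no centre.

When [K] has dimension at least [n - 1], this criterion applies to every
relative interior point [y] of [K], and these are dense in [K]
([relative_interior_point], [closure_relative_interior]).  The criterion is
clear near a centre [x0] at distance less than 1 from [y].  If
[v = x0 - y] has norm 1, then [v] is transversal to the direction [U] of
[aff K], because [K] contains a neighbourhood of [y] in [y + U], and the
boundary of the unit ball around [x0] is flat there.  So [U] is a hyperplane,
and since the whole space is [U + R v], a centre [z] for [{s0}] near [x0] has
the form [y + u + t v] with [u] in [U] small and [t] close to 1.  Flatness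
makes [`|u' + t v|] at least [t] for all [u'] in [U]; as [z - s0] has that
form and norm at most 1, [t <= 1], and then [z - y = t (u / t + v)] has norm at
most 1, by flatness again ([hyperplane_local]).

When [K] has dimension at most 1, [S] lies on a line through any [y] in [K].
Sliding a unit ball along this line shows that [y] cannot be separated from
[S] on the line, so [y] is between two points of [S] or a limit of points of
[S] ([closure_finitary_line]). *)

(** * Ball hulls and their finitary parts *)

Section BallHull.
Variables (R : realType) (V : normedModType R).
Implicit Types (S F : set V) (p q u v x y z : V).

Definition finitary_ball_hull1 S : set V :=
  \bigcup_(F in [set F : set V | F `<=` S /\ finite_set F]) ball_hull1 F.

Lemma sub_ball_hull1 S : S `<=` ball_hull1 S.
Proof. by move=> s Ss x; apply. Qed.

Lemma ball_hull1_mono F S : F `<=` S -> ball_hull1 F `<=` ball_hull1 S.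
Proof. by move=> FS y Fy x Sx; apply: Fy => s /FS /Sx. Qed.

Lemma cball_closed x (r : R) : closed (cball x r).
Proof.
rewrite (_ : cball x r = closed_ball_ Num.norm x r); first exact: closed_closed_ball_.
by apply/seteqP; split => y; rewrite /cball /closed_ball_ /= distrC.
Qed.

Lemma ball_hull1_closed S : closed (ball_hull1 S).
Proof. by apply: closed_bigI => x _; exact: cball_closed. Qed.

Lemma closure_finitary_ball_hull1_sub S :
  closure (finitary_ball_hull1 S) `<=` ball_hull1 S.
Proof.
rewrite [X in _ `<=` X](_ : _ = closure (ball_hull1 S)); last first.
  by rewrite -(closure_id (ball_hull1 S)).1//; exact: ball_hull1_closed.
by apply: closure_subset => y [F [FS _]]; exact: ball_hull1_mono.
Qed.

Lemma sub_finitary_ball_hull1 S : S `<=` finitary_ball_hull1 S.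
Proof.
move=> s Ss; exists [set s]; last exact: sub_ball_hull1.
by split; [move=> _ -> | exact: finite_set1].
Qed.

Lemma closure_dist (A : set V) y :
  (forall e, 0 < e -> exists2 z, A z & `|y - z| < e) -> closure A y.
Proof.
move=> Ay B /nbhs_normP[e /= e0 eB]; have [z Az yz] := Ay e e0.
by exists z; split => //; apply: eB.
Qed.

(** Convexity of balls, parametrised along a line: this is the only form of
convexity used below. *)
Lemma norm_segment_le q u (a b t r : R) : a <= t <= b ->
  `|q + a *: u| <= r -> `|q + b *: u| <= r -> `|q + t *: u| <= r.
Proof.
move=> /andP[at_ tb] qa qb; have [ab|ab] := leP b a.
  by have -> : t = a by lra.
have [l [l0 l1 ->]] : exists l, [/\ 0 <= l, l <= 1 & t = (1 - l) * a + l * b].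
  exists ((t - a) / (b - a)); split; last by field; lra.
  - by rewrite divr_ge0 ?subr_ge0// ltW.
  - by rewrite ler_pdivrMr ?mul1r ?lerB// subr_gt0.
have -> : q + ((1 - l) * a + l * b) *: u =
    (1 - l) *: (q + a *: u) + l *: (q + b *: u).
  by rewrite !scalerDr !scalerA addrACA -!scalerDl subrK scale1r.
rewrite (le_trans (ler_normD _ _))// !normrZ !ger0_norm ?subr_ge0//.
move: (`|q + a *: u|) (`|q + b *: u|) qa qb => A B qa qb; nra.
Qed.

Lemma ball_hull1_segment S q u (a b t : R) : a <= t <= b ->
  ball_hull1 S (q + a *: u) -> ball_hull1 S (q + b *: u) ->
  ball_hull1 S (q + t *: u).
Proof.
move=> atb Sa Sb x Sx; move: (Sa x Sx) (Sb x Sx); rewrite /cball /=.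
by rewrite ![_ + _ - x]addrAC; exact: norm_segment_le.
Qed.

Lemma ball_hull1_mid S x y :
  ball_hull1 S x -> ball_hull1 S y -> ball_hull1 S (2^-1 *: (x + y)).
Proof.
move=> Sx Sy.
have -> : 2^-1 *: (x + y) = x + 2^-1 *: (y - x).
  rewrite [in RHS]scalerBr addrCA -[X in _ + (X - _)]scale1r -scalerBl.
  by rewrite scalerDr addrC; congr (_ + _ *: _); lra.
apply: (@ball_hull1_segment S x (y - x) 0 1); first by apply/andP; split; lra.
- by rewrite scale0r addr0.
- by rewrite scale1r addrC subrK.
Qed.

(** The complements of the balls [cball s 1], for [s] in [S], cover all of
[cball s0 1] but the centres for [S]; near those, the hypothesis takes over.
A finite subcover then yields the finite subset of [S]. *)
Lemma finitary_ball_hull1_local S s0 y :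
  compact (cball s0 1) -> S s0 ->
  (forall x, S `<=` cball x 1 ->
    \forall z \near x, cball s0 1 z -> cball y 1 z) ->
  finitary_ball_hull1 S y.
Proof.
move=> cs0 Ss0 loc.
pose U := [set x | cball s0 1 x -> cball y 1 x]°.
have cA : compact (cball s0 1 `\` U).
  apply: subclosed_compact cs0 _; last by move=> ? [].
  by apply: closedI; [exact: cball_closed | apply: open_closedC; exact: open_interior].
move: cA; rewrite compact_cover => /(_ V S (fun s => ~` cball s 1)) [].
- by move=> s _; apply: closed_openC; exact: cball_closed.
- move=> x [s0x Ux]; apply: contrapT => nx; apply: Ux.
  apply: loc => s Ss; apply: contrapT => xs; apply: nx.
  by exists s => // sx; apply: xs; rewrite /cball /= distrC.
move=> D DS covD; exists (s0 |` [set` D]) => [|x Fx].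
  split; last by rewrite finite_setU; split; [exact: finite_set1 | exact: finite_fset].
  by move=> s [-> //|/= /DS /set_mem].
have Fxs s : (s0 |` [set` D]) s -> cball s 1 x.
  by move=> /Fx; rewrite /cball /= distrC.
have [Ux|nUx] := pselect (U x).
  rewrite /cball /= distrC; apply: (interior_subset Ux).
  by apply: Fxs; left.
have [|s sD] := covD x; last by case; apply: Fxs; right.
by split => //; apply: Fxs; left.
Qed.

(** * The case of a line *)

(** A ball around [x] meets the line in a segment.  If [S] stayed at parameters
at least [h > 0], the ball could be slid forward until this segment starts
between [0] and [h], which excludes [y] while keeping [S]. *)
Lemma ball_hull1_beyond S y u x (h : R) : u != 0 -> 0 < h ->
  S `<=` cball x 1 ->
  (forall s, S s -> exists2 t, h <= t & s = y + t *: u) ->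
  ~ ball_hull1 S y.
Proof.
move=> u0 h0 Sx line Sy.
pose E := [set t : R | `|y + t *: u - x| <= 1].
have E0 : E 0 by rewrite /E /= scale0r addr0; exact: Sy.
have Elb : has_lbound E.
  exists (- ((1 + `|y - x|) / `|u|)) => t Et.
  rewrite lerNl ler_pdivlMr ?normr_gt0// (le_trans (ler_wpM2r _ (ler_norm _)))//.
  rewrite normrN -normrZ.
  have -> : t *: u = (y + t *: u - x) - (y - x).
    by rewrite opprB addrA subrK addrAC subrr add0r.
  by rewrite (le_trans (ler_normB _ _))// lerD2r.
(* [t0] is within [h] of the point where the line enters the ball. *)
have [t0 [Et0 t0le nEt0]] : exists t0, [/\ E t0, t0 <= 0 & ~ E (t0 - h)].
  have infE : has_inf E by split; [exists 0|].
  have [e Ee eE] := inf_adherent h0 infE.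
  have nE t : t < e -> ~ E (t - h).
    by move=> te /(ge_inf Elb); lra.
  have [e0|e0] := leP e 0; last by exists 0; split => //; exact: nE.
  by exists e; split => // /(ge_inf Elb); lra.
(* The ball is slid by [h - t0] along [u]: it then contains the part of the
   line from [h] on that it met before, but misses [y]. *)
have : `|y - (x + (h - t0) *: u)| <= 1.
  apply: Sy => s Ss; have [t ht st] := line s Ss.
  have Et : E t by rewrite /E /= -st; exact: Sx.
  have -> : cball (x + (h - t0) *: u) 1 s =
            (`|(y - x) + (t - (h - t0)) *: u| <= 1) :> Prop.
    rewrite /cball /= st; congr (is_true (`| _ | <= 1)).
    by rewrite opprD addrACA -scalerBl.
  apply: (@norm_segment_le _ _ t0 t); first by apply/andP; split; lra.
  - by rewrite addrAC.
  - by rewrite addrAC.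
apply: contra_not nEt0 => /=; rewrite /E /=; congr (is_true (`| _ | <= 1)).
by rewrite opprD addrA addrAC -scaleNr opprB.
Qed.

Lemma closure_one_sided S y u x : u != 0 -> S `<=` cball x 1 ->
  ball_hull1 S y -> (forall s, S s -> exists2 t, 0 <= t & s = y + t *: u) ->
  closure S y.
Proof.
move=> u0 Sx Sy line; apply: closure_dist => e e0; apply: contrapT => far.
apply: (@ball_hull1_beyond S y u x (e / `|u|)) Sy => //.
  by rewrite divr_gt0// normr_gt0.
move=> s Ss; have [t t0 st] := line s Ss; exists t => //.
rewrite leNgt; apply/negP => te; apply: far; exists s => //.
rewrite st opprD addrA subrr sub0r normrN normrZ ger0_norm//.
by rewrite -ltr_pdivlMr// normr_gt0.
Qed.

Lemma closure_finitary_line S s0 y u :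
  compact (cball s0 1) -> S s0 -> ball_hull1 S y ->
  (forall s, S s -> exists t, s = y + t *: u) ->
  closure (finitary_ball_hull1 S) y.
Proof.
move=> cs0 Ss0 Sy line.
have clS : closure S `<=` closure (finitary_ball_hull1 S).
  by apply: closure_subset; exact: sub_finitary_ball_hull1.
have [u0|u0] := eqVneq u 0.
  have [t s0y] := line s0 Ss0; apply: clS; apply: subset_closure.
  by move: s0y; rewrite u0 scaler0 addr0 => <-.
have [[x Sx]|noball] := pselect (exists x, S `<=` cball x 1); last first.
  apply: subset_closure; apply: finitary_ball_hull1_local cs0 Ss0 _ => x Sx.
  by case: noball; exists x.
have [[s [t [Ss t0 st]]]|npos] :=
  pselect (exists s t, [/\ S s, 0 <= t & s = y + t *: u]); last first.
  apply: clS; apply: (@closure_one_sided S y (- u) x) => //.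
    by rewrite oppr_eq0.
  move=> s Ss; have [t st] := line s Ss; exists (- t); last first.
    by rewrite scalerN scaleNr opprK.
  rewrite leNgt; apply/negP => t0; apply: npos; exists s, t; split => //; lra.
have [[s' [t' [Ss' t'0 st']]]|nneg] :=
  pselect (exists s t, [/\ S s, t <= 0 & s = y + t *: u]); last first.
  apply: clS; apply: (@closure_one_sided S y u x) => //.
  move=> s' Ss'; have [t' st'] := line s' Ss'; exists t' => //.
  rewrite leNgt; apply/negP => t'0; apply: nneg; exists s', t'.
  split => //; exact: ltW.
apply: subset_closure; exists [set s'; s].
  by split; [move=> _ [->|->] | rewrite finite_setU; split; exact: finite_set1].
rewrite -[y]addr0 -(scale0r u); apply: (@ball_hull1_segment _ y u t' t).
- exact/andP.
- by apply: sub_ball_hull1; left; rewrite st'.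
- by apply: sub_ball_hull1; right; rewrite st.
Qed.

End BallHull.

(** * Comparison with the sup norm *)

(** All norms on ['rV[R]_n] are equivalent, so the compactness of bounded closed
sets and the boundedness of linear forms carry over to Minkowski spaces. *)

Section SupNorm.
Variables (R : realType) (n : nat) (N : rVnorm R n).
Implicit Types (x y : 'rV[R]_n).

Lemma coord_le_sup_norm x i : `|x 0 i| <= `|x|.
Proof.
rewrite [leRHS]/Num.norm /= mx_normrE.
by apply/bigmax_geP; right => /=; exists (0, i).
Qed.

Lemma minkowski_norm_sum (I : finType) (a : I -> R) (v : I -> minkowski N) :
  `|\sum_i a i *: v i| <= \sum_i `|a i| * `|v i|.
Proof.
rewrite (le_trans (ler_norm_sum _ _ _))//.
by apply: ler_sum => i _; rewrite normrZ.
Qed.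

Lemma minkowski_norm_le_sup :
  exists2 c : R, 0 < c & forall x, `|(x : minkowski N)| <= c * `|x|.
Proof.
exists (\sum_i `|(delta_mx 0 i : minkowski N)| + 1) => [|x].
  by rewrite ltr_wpDl// sumr_ge0.
rewrite [in leLHS](row_sum_delta x) (le_trans (minkowski_norm_sum _ _))//.
rewrite mulrDl mulr_suml ler_wpDr ?mul1r//; apply: ler_sum => i _.
by rewrite mulrC ler_wpM2l// coord_le_sup_norm.
Qed.

Lemma minkowski_id_continuous :
  continuous (fun x : 'rV[R]_n => (x : minkowski N)).
Proof.
have [c c0 Nc] := minkowski_norm_le_sup.
move=> x; apply/(@cvgrPdist_lt _ _ _ _ (nbhs_filter x)) => e e0.
apply/(@nbhs_normP R 'rV[R]_n x).
exists (e / c) => /=; first by rewrite divr_gt0.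
move=> y /= xy; rewrite (le_lt_trans (Nc (x - y)))//.
by rewrite mulrC -ltr_pdivlMr.
Qed.

(** [N] is continuous, hence has a positive minimum on the unit sphere of the
sup norm, which is compact; homogeneity does the rest. *)
Lemma sup_norm_le_minkowski :
  exists2 c : R, 0 < c & forall x, `|x| <= c * `|(x : minkowski N)|.
Proof.
pose A : set 'rV[R]_n := [set x | `|x| = 1].
have [[a Aa]|A0] := pselect (A !=set0); last first.
  exists 1 => // x; have [->|x0] := eqVneq x 0.
    by rewrite normr0 mul1r.
  case: A0; exists (`|x|^-1 *: x).
  by rewrite /A /= normrZ normfV normr_id mulVf// normr_eq0.
have cA : compact A.
  apply: bounded_closed_compact.
    by exists 1; split => // M M1 x /= ->; exact: ltW.
  rewrite (_ : A = Num.norm @^-1` [set 1]) //.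
  apply: closed_comp; last exact: closed_eq.
  by move=> x _; exact: norm_continuous.
have cN : {within A, continuous (fun x => `|(x : minkowski N)|)}.
  apply: continuous_subspaceT => x.
  apply: (@continuous_comp _ _ _ (fun x : 'rV[R]_n => (x : minkowski N)) Num.norm).
    exact: minkowski_id_continuous.
  exact: norm_continuous.
have [b /set_mem Ab minb] := EVT_min_rV (ex_intro _ a Aa) cA cN.
have b0 : 0 < `|(b : minkowski N)|.
  rewrite normr_gt0; apply/eqP => b0; move: Ab; rewrite /A /= (b0 : b = 0).
  by rewrite normr0; lra.
exists (`|(b : minkowski N)|^-1) => [|x]; first by rewrite invr_gt0.
have [->|x0] := eqVneq x 0; first by rewrite normr0 mulr_ge0// invr_ge0 ltW.
have xN : 0 < `|x| by rewrite normr_gt0.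
have : `|(b : minkowski N)| <= `|(`|x|^-1 *: x : minkowski N)|.
  by apply/minb/mem_set; rewrite /A /= normrZ normfV normr_id mulVf// gt_eqF.
rewrite normrZ normfV normr_id mulrC ler_pdivlMr// => h.
by rewrite mulrC ler_pdivlMr// mulrC.
Qed.

Lemma minkowski_cball_compact (x : minkowski N) (r : R) : compact (cball x r).
Proof.
have [c c0 cN] := sup_norm_le_minkowski.
rewrite -[cball x r]image_id.
apply: (@continuous_compact 'rV[R]_n (minkowski N) id).
  by apply: continuous_subspaceT; exact: minkowski_id_continuous.
apply: bounded_closed_compact.
  exists (c * (`|x| + r)); split; first exact: num_real.
  move=> M /ltW xM y xy; apply: le_trans (cN y) (le_trans _ xM).
  rewrite ler_wpM2l ?(ltW c0)// -(subrK x (y : minkowski N)) addrC.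
  by rewrite (le_trans (ler_normD _ _))// lerD2l.
apply: (@closed_comp 'rV[R]_n (minkowski N) id (cball x r)).
  by move=> y _; exact: minkowski_id_continuous.
exact: cball_closed.
Qed.

Lemma minkowski_form_bounded (f : {scalar minkowski N}) :
  exists2 c, 0 < c & forall x : minkowski N, `|f x : R| <= c * `|x|.
Proof.
have [c c0 cN] := sup_norm_le_minkowski.
pose m : R := \sum_i `|f (delta_mx 0 i) : R|.
have m0 : 0 <= m by rewrite sumr_ge0.
exists ((m + 1) * c) => [|x]; first by rewrite mulr_gt0// ltr_wpDl.
rewrite -mulrA; have m1 : 0 <= m + 1 by rewrite addr_ge0.
have h := ler_wpM2l m1 (cN x).
apply: (le_trans _ h).
have -> : f x = \sum_i x 0 i * f (delta_mx 0 i).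
  rewrite [in LHS](row_sum_delta x) linear_sum.
  by apply: eq_bigr => i _; rewrite linearZ.
rewrite (le_trans (ler_norm_sum _ _ _))// mulrDl mul1r ler_wpDr// mulr_suml.
apply: ler_sum => i _; rewrite normrM mulrC ler_wpM2l//.
exact: coord_le_sup_norm.
Qed.

End SupNorm.

(** * Relative interior of a ball hull *)

Section RelativeInterior.
Variables (R : realType) (n : nat) (N : rVnorm R n).
Local Notation V := (minkowski N).
Implicit Types (S : set V) (U : {vspace V}) (x y z u v : V).

(** The midpoint [y] of the chord depends on [v]; [box_in_ball_hull1] finds a
common one for finitely many directions. *)
Definition chord_direction S v :=
  exists y, exists2 d, 0 < d & forall t, `|t| <= d -> ball_hull1 S (y + t *: v).

Lemma chord_direction_diff S x y :
  ball_hull1 S x -> ball_hull1 S y -> chord_direction S (y - x).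
Proof.
move=> Sx Sy; exists (x + 2^-1 *: (y - x)), 2^-1 => [|t]; first by lra.
rewrite ler_norml => /andP[t1 t2]; rewrite -addrA -scalerDl.
apply: (@ball_hull1_segment _ _ S x (y - x) 0 1); first by apply/andP; split; lra.
- by rewrite scale0r addr0.
- by rewrite scale1r addrC subrK.
Qed.

Lemma chord_directionD S u v :
  chord_direction S u -> chord_direction S v -> chord_direction S (u + v).
Proof.
move=> [x [d d0 xu]] [y [e e0 yv]].
exists (2^-1 *: (x + y)), (2^-1 * Num.min d e) => [|t].
  by rewrite mulr_gt0 ?invr_gt0// lt_min d0.
rewrite mulrC ler_pdivlMr// -[X in _ * X](@ger0_norm _ 2)// -normrM le_min.
move=> /andP[td te].
have -> : 2^-1 *: (x + y) + t *: (u + v) =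
    2^-1 *: ((x + (t * 2) *: u) + (y + (t * 2) *: v)).
  rewrite [in RHS]addrACA -[in RHS](scalerDr (t * 2)) [RHS]scalerDr scalerA.
  by congr (_ + _ *: _); field.
by apply: ball_hull1_mid; [exact: xu | exact: yv].
Qed.

Lemma chord_directionZ S c v : chord_direction S v -> chord_direction S (c *: v).
Proof.
move=> [y [d d0 yv]]; have c1 : 0 < `|c| + 1 by rewrite ltr_wpDl.
exists y, (d / (`|c| + 1)) => [|t]; first exact: divr_gt0.
rewrite ler_pdivlMr// => td; rewrite scalerA; apply: yv.
by rewrite normrM (le_trans _ td)// ler_wpM2l// lerDl.
Qed.

(** The chord directions contain the differences of points of the hull and are
closed under linear combinations, hence contain any difference of two affine
combinations of points of the hull. *)
Lemma chord_direction_affine S p U : ball_hull1 S !=set0 ->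
  affine_hull (ball_hull1 S) = [set p + u | u in [set u | u \in U]] ->
  forall u, u \in U -> chord_direction S u.
Proof.
move=> [k Sk] aff.
have comb (m : nat) (a : 'I_m -> R) (q : 'I_m -> V) :
    (forall i, ball_hull1 S (q i)) ->
    chord_direction S (\sum_i a i *: (q i - k)).
  move=> Sq; apply: (big_ind (chord_direction S)).
  - by rewrite -(subrr k); exact: chord_direction_diff.
  - exact: chord_directionD.
  - by move=> i _; apply/chord_directionZ/chord_direction_diff.
have trans (m : nat) (a : 'I_m -> R) (q : 'I_m -> V) : \sum_i a i = 1 ->
    \sum_i a i *: q i = k + \sum_i a i *: (q i - k).
  move=> a1; under [in RHS]eq_bigr => i _ do rewrite scalerBr.
  by rewrite sumrB -scaler_suml a1 scale1r addrC subrK.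
have affU v : v \in U -> affine_hull (ball_hull1 S) (p + v).
  by move=> vU; rewrite aff; exists v.
move=> u uU; have [m [a [q [Sq a1 pu]]]] := affU u uU.
have [m' [a' [q' [Sq' a'1 p0]]]] := affU 0 (mem0v U).
have -> : u = \sum_i a i *: (q i - k) + -1 *: \sum_i a' i *: (q' i - k).
  have <- : (p + u) - (p + 0) = u by rewrite addr0 addrAC subrr add0r.
  rewrite pu p0 (trans _ _ _ a1) (trans _ _ _ a'1) scaleN1r.
  by rewrite opprD addrACA subrr add0r.
by apply: chord_directionD; [exact: comb | apply/chord_directionZ/comb].
Qed.

(** By induction on [r]: the midpoints between a box in the remaining
directions and a chord in the direction [b i] fill a box of half the size. *)
Lemma box_in_ball_hull1 S (I : Type) (b : I -> V) (r : seq I) :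
  ball_hull1 S !=set0 -> (forall i, chord_direction S (b i)) ->
  exists y, exists2 d, 0 < d &
    forall c : I -> R, (forall i, `|c i| <= d) ->
      ball_hull1 S (y + \sum_(i <- r) c i *: b i).
Proof.
move=> [k Sk] Sb; elim: r => [|i r [y [d d0 yd]]].
  by exists k, 1 => // c _; rewrite big_nil addr0.
have [x [e e0 xe]] := Sb i.
exists (2^-1 *: (x + y)), (2^-1 * Num.min d e) => [|c cd].
  by rewrite mulr_gt0 ?invr_gt0// lt_min d0.
have c2 j : (`|2 * c j| <= d) && (`|2 * c j| <= e).
  by rewrite -le_min normrM ger0_norm// mulrC -ler_pdivlMr// mulrC.
have -> : 2^-1 *: (x + y) + \sum_(j <- i :: r) c j *: b j =
    2^-1 *: ((x + (2 * c i) *: b i) + (y + \sum_(j <- r) (2 * c j) *: b j)).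
  rewrite big_cons addrACA [in RHS]scalerDr; congr (_ + _).
  under [in RHS]eq_bigr => j _ do rewrite -scalerA.
  by rewrite -scalerA -scaler_sumr -scalerDr scalerA mulVf ?pnatr_eq0// scale1r.
apply: ball_hull1_mid; first by apply: xe; case/andP: (c2 i).
by apply: yd => j; case/andP: (c2 j).
Qed.

(** The box over a basis of [U] contains a neighbourhood of its centre in [U],
because the coordinate forms are bounded. *)
Lemma relative_interior_point S p U : ball_hull1 S !=set0 ->
  affine_hull (ball_hull1 S) = [set p + u | u in [set u | u \in U]] ->
  exists y, exists2 d, 0 < d &
    forall u, u \in U -> `|u| <= d -> ball_hull1 S (y + u).
Proof.
move=> S0 aff; pose b i := (vbasis U)`_i.
have bU (i : 'I_(\dim U)) : b i \in U by rewrite vbasis_mem// mem_nth// size_tuple.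
have [y [d d0 yd]] := box_in_ball_hull1 (index_enum 'I_(\dim U)) S0
  (fun i => chord_direction_affine S0 aff (bU i)).
have /choice[c cP] : forall i : 'I_(\dim U), exists c, 0 < c /\
    forall u, `|coord (vbasis U) i u| <= c * `|u|.
  move=> i; have [c c0 cb] := minkowski_form_bounded (coord (vbasis U) i).
  by exists c.
pose M := \sum_i c i + 1.
have cM i : c i <= M.
  rewrite /M (bigD1 i)//= -addrA lerDl addr_ge0// sumr_ge0// => j _.
  by apply: ltW; case: (cP j).
have M0 : 0 < M.
  by rewrite ltr_wpDl// sumr_ge0// => j _; apply: ltW; case: (cP j).
exists y, (d / M) => [|u uU]; first exact: divr_gt0.
rewrite ler_pdivlMr// => ud; rewrite (coord_vbasis uU); apply: yd => i.
rewrite (le_trans ((cP i).2 u))// (le_trans _ ud)// mulrC ler_wpM2l//.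
Qed.

(** The hull is convex, so the points of the segment from [z] to the relative
interior point [y], except perhaps [z], are relative interior points. *)
Lemma closure_relative_interior S U (A : set V) y d :
  0 < d -> (forall u, u \in U -> `|u| <= d -> ball_hull1 S (y + u)) ->
  (forall x e, 0 < e ->
     (forall u, u \in U -> `|u| <= e -> ball_hull1 S (x + u)) -> A x) ->
  ball_hull1 S `<=` closure A.
Proof.
move=> d0 yd Aint z Sz; apply: closure_dist => e e0.
have w0 : 0 < `|y - z| + 1 by rewrite ltr_wpDl.
pose t := Num.min 1 (2^-1 * (e / (`|y - z| + 1))).
have t0 : 0 < t by rewrite lt_min ltr01 mulr_gt0 ?invr_gt0 ?divr_gt0.
have t1 : t <= 1 by rewrite ge_min lexx.
exists (z + t *: (y - z)); last first.
  rewrite opprD addrA subrr sub0r normrN normrZ gtr0_norm//.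
  have te : t * (`|y - z| + 1) <= 2^-1 * e.
    by rewrite -ler_pdivlMr// -mulrA ge_min lexx orbT.
  have := normr_ge0 (y - z); nra.
apply: (Aint _ (t * d)); first exact: mulr_gt0.
move=> u uU ud.
have Syu : ball_hull1 S (y + t^-1 *: u).
  apply: yd; first exact: memvZ.
  by rewrite normrZ normfV gtr0_norm// mulrC ler_pdivrMr// mulrC.
have -> : z + t *: (y - z) + u = z + t *: (y + t^-1 *: u - z).
  by rewrite -addrA (addrAC y) [in RHS](scalerDr t (y - z)) scalerA mulfV ?gt_eqF// scale1r.
apply: (@ball_hull1_segment _ _ S z _ 0 1); first by rewrite ltW.
- by rewrite scale0r addr0.
- by rewrite scale1r addrC subrK.
Qed.

End RelativeInterior.

(** * The case of codimension at most one *)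

Section Hyperplane.
Variables (R : realType) (n : nat) (N : rVnorm R n).
Local Notation V := (minkowski N).
Implicit Types (S : set V) (U : {vspace V}) (x y z u v : V).

Lemma hyperplane_complement U v : (n.-1 <= \dim U)%N -> v \notin U ->
  forall w : V, exists2 u, u \in U & exists t, w = u + t *: v.
Proof.
move=> Un vU w.
have : w \in (U + <[v]>)%VS.
  suff -> : (U + <[v]>)%VS = fullv by rewrite memvf.
  apply/eqP; rewrite eqEdim subvf minkowski_dim.
  have dUv : (\dim U < \dim (U + <[v]>))%N.
    rewrite ltnNge (geq_leqif (dimv_leqif_sup (addvSl U <[v]>))).
    by rewrite subv_add subvv -memvE.
  by rewrite (leq_trans (leqSpred n))// (leq_trans _ dUv).
by case/memv_addP => u uU [_ /vlineP[t ->] ->]; exists u => //; exists t.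
Qed.

(** The unit ball contains [u + v] for all small [u] in [U], so its point [v] is
in the relative interior of a flat piece parallel to [U].  If [u + v] had norm
less than 1 for some [u] in [U], then [v], strictly between [u + v] and a point
[v - m u] of this piece, would have norm less than 1 as well. *)
Lemma norm_ge_transversal U v d : 0 < d -> `|v| = 1 ->
  (forall u, u \in U -> `|u| <= d -> `|u + v| <= 1) ->
  forall u t, u \in U -> `|t| <= `|u + t *: v|.
Proof.
move=> d0 v1 flat; have unit_case u : u \in U -> 1 <= `|u + v|.
  move=> uU; rewrite leNgt; apply/negP => uv1.
  have w0 : 0 < `|u| + 1 by rewrite ltr_wpDl.
  pose m := d / (`|u| + 1); have m0 : 0 < m by rewrite divr_gt0.
  have : `|- (m *: u) + v| <= 1.
    apply: flat; first by rewrite memvN memvZ.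
    by rewrite normrN normrZ gtr0_norm// mulrAC ler_pdivrMr// ler_wpM2l ?ltW// ltrDl.
  have : `|m *: (u + v) + (- (m *: u) + v)| = 1 + m.
    rewrite scalerDr addrACA subrr add0r -[X in _ + X]scale1r -scalerDl.
    by rewrite normrZ v1 mulr1 ger0_norm 1?addrC// addr_ge0// ltW.
  have := ler_normD (m *: (u + v)) (- (m *: u) + v).
  rewrite normrZ (gtr0_norm m0); nra.
move=> u t uU; have [->|t0] := eqVneq t 0; first by rewrite normr0.
have -> : u + t *: v = t *: (t^-1 *: u + v).
  by rewrite scalerDr scalerA mulfV// scale1r.
by rewrite normrZ ler_peMr// unit_case// memvZ.
Qed.

(** If [x0] is at distance 1 from [y], the ball around [x0] is flat near [y] in
the directions of [U], and [S] is in [y + U].  Points [z] near [x0] that are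
within distance 1 of [s0] cannot lie further from [y + U] than [x0] does, and
seen from [y] they are therefore in a slightly shrunk copy of the flat
piece. *)
Lemma hyperplane_local S U s0 x0 y d : (n.-1 <= \dim U)%N -> S s0 ->
  (forall s, S s -> s - y \in U) -> 0 < d ->
  (forall u, u \in U -> `|u| <= d -> ball_hull1 S (y + u)) ->
  S `<=` cball x0 1 ->
  \forall z \near x0, cball s0 1 z -> cball y 1 z.
Proof.
move=> Un Ss0 SU d0 yd Sx0.
have yx : `|y - x0| <= 1.
  by rewrite -[y]addr0; apply: yd Sx0; rewrite ?mem0v ?normr0// ltW.
have [yx1|yx1] := ltP `|y - x0| 1.
  apply/nbhs_normP; exists (1 - `|y - x0|) => /=; first by rewrite subr_gt0.
  move=> z /= xz _; rewrite /cball /= distrC -(subrK x0 y) -addrA.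
  by rewrite (le_trans (ler_normD _ _))//; lra.
pose v := x0 - y.
have v1 : `|v| = 1 by apply/le_anti; rewrite distrC yx yx1.
have flat u : u \in U -> `|u| <= d -> `|u + v| <= 1.
  move=> uU ud; rewrite -normrN opprD opprB addrA (addrC (- u)).
  by apply: yd Sx0; rewrite ?memvN ?normrN.
have vU : v \notin U.
  apply/negP => vU; have : `|d *: v + v| <= 1.
    by apply: flat; rewrite ?memvZ// normrZ v1 mulr1 gtr0_norm.
  rewrite -[X in _ + X]scale1r -scalerDl normrZ v1 mulr1 gtr0_norm; lra.
have norm_ge := norm_ge_transversal d0 v1 flat.
(* With [`|z - x0| < e], the component [u] of [z - x0] satisfies [`|u| < 2 e],
   and [t > 1/2]; then [`|u / t| <= d]. *)
pose e := Num.min 2^-1 (d / 4).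
have e0 : 0 < e by rewrite lt_min invr_gt0 ltr0n divr_gt0.
apply/nbhs_normP; exists e => //= z xz s0z.
have [u uU [t' zE]] := hyperplane_complement Un vU (z - x0).
have xz' : `|u + t' *: v| < e by rewrite -zE distrC.
have t'e : `|t'| < e by apply: le_lt_trans xz'; exact: norm_ge.
have ue : `|u| < 2 * e.
  rewrite -[u](addrK (t' *: v)) (le_lt_trans (ler_normB _ _))//.
  by rewrite normrZ v1 mulr1 mulr2n mulrDl mul1r ltrD.
have [e2 e4] : e <= 2^-1 /\ e <= d / 4 by rewrite /e !ge_min !lexx orbT.
move: (t'e); rewrite ltr_norml => /andP[t'1 t'2].
pose t := 1 + t'.
have zyE : z - y = u + t *: v.
  by rewrite scalerDl scale1r addrCA -zE /v [RHS]addrC addrA subrK.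
have t1 : t <= 1.
  have zs : z - s0 = (u - (s0 - y)) + t *: v.
    by rewrite addrAC -zyE opprB addrA subrK.
  apply: le_trans (ler_norm t) _; apply: le_trans s0z.
  by rewrite zs; apply: norm_ge; rewrite memvB// SU.
have t0 : 0 < t by rewrite /t; lra.
rewrite /cball /= zyE.
have -> : u + t *: v = t *: (t^-1 *: u + v).
  by rewrite [RHS]scalerDr scalerA mulfV ?gt_eqF// scale1r.
rewrite normrZ gtr0_norm//; apply: mulr_ile1 => //; first exact: ltW.
apply: flat; first exact: memvZ.
rewrite normrZ normfV gtr0_norm// mulrC ler_pdivrMr// /t; nra.
Qed.

End Hyperplane.

(** * The ball hull is the closure of the finitary ball hull *)

Lemma sub_affine_hull (R : realType) (V : lmodType R) (A : set V) : A `<=` affine_hull A.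
Proof.
move=> y Ay; exists 1%N, (fun=> 1), (fun=> y); split => //.
  by rewrite big_ord1.
by rewrite big_ord1 scale1r.
Qed.

Theorem theorem2 (R : realType) (n : nat) (hn : (1 <= n)%N)
    (N : rVnorm R n) (S : set (minkowski N)) (hS : S !=set0)
    (hdim : exists2 d : nat, d \in [:: 0; 1; n.-1; n]%N &
              has_affine_dim (affine_hull (ball_hull1 S)) d) :
  ball_hull1 S =
  closure (\bigcup_(F in [set F : set (minkowski N) | F `<=` S /\ finite_set F])
             ball_hull1 F).
Proof.
rewrite -/(finitary_ball_hull1 S).
apply/seteqP; split; last exact: closure_finitary_ball_hull1_sub.
have [s0 Ss0] := hS; have cs0 := @minkowski_cball_compact _ _ N s0 1.
have K0 : ball_hull1 S !=set0 by exists s0; exact: sub_ball_hull1.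
have [d dn [p [U [dU aff]]]] := hdim.
have hullU x y : ball_hull1 S x -> ball_hull1 S y -> x - y \in U.
  move=> /sub_affine_hull + /sub_affine_hull; rewrite aff.
  move=> [u uU <-] [v vU <-].
  by rewrite opprD addrACA subrr add0r memvB.
have [d1|dn1] : (d <= 1)%N \/ (n.-1 <= d)%N.
  move: dn; rewrite !inE => /or4P[] /eqP ->; try by [left].
  - by right.
  - by right; exact: leq_pred.
- have Uu : (U <= <[vpick U]>)%VS.
    have uU : (<[vpick U]> <= U)%VS by rewrite -memvE memv_pick.
    rewrite -(geq_leqif (dimv_leqif_sup uU)) dim_vline vpick0 dU.
    have [U0|//] := eqVneq U 0%VS.
    by rewrite -dU U0 dimv0.
  move=> y Sy; apply: (@closure_finitary_line _ _ S s0 y (vpick U)) => // s Ss.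
  have /(subvP Uu)/vlineP[t st] := hullU s y (sub_ball_hull1 Ss) Sy.
  by exists t; rewrite -st addrC subrK.
- have [y [e e0 ye]] := relative_interior_point K0 aff.
  apply: (closure_relative_interior e0 ye) => x r r0 xr.
  have Sx : ball_hull1 S x.
    by rewrite -[x]addr0; apply: xr; rewrite ?mem0v ?normr0// ltW.
  apply: (finitary_ball_hull1_local cs0 Ss0) => x0 Sx0.
  apply: (@hyperplane_local _ _ _ S U s0 x0 x r) => //; first by rewrite dU.
  by move=> s Ss; apply: hullU => //; exact: sub_ball_hull1.
Qed.
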